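(* The following rules are derivable in $\mathbf{GAMALL}$, for every formula $A$ and all finite multisets of formulae $\Gamma,\Delta$: $(R\Diamond')$ from $\Gamma\Rightarrow\Delta,A$ infer $\Gamma\Rightarrow\Delta,\Diamond A$; $(L\boxdot')$ from $\Gamma,A\Rightarrow\Delta$ infer $\Gamma,\boxdot A\Rightarrow\Delta$.
   Context: Formulae are built from propositional variables and constants $0,1,\bot,\top$ using the connectives $\otimes$, $\oplus$ (multiplicative disjunction, ''par''), $\land$, $\lor$ (additive conjunction and disjunction), $\neg$, $\to$. A sequent $\Gamma\Rightarrow\Delta$ is a pair of finite multisets of formulae; commas denote multiset union. A rule is derivable in a calculus if its conclusion can be derived from its premisses using the rules of the calculus. The calculus $\mathbf{GMALL}$ for Multiplicative Additive Linear Logic has the following rules (no cut, weakening or contraction). Axioms: $A\Rightarrow A$; $0\Rightarrow{}$; ${}\Rightarrow 1$; $\bot,\Gamma\Rightarrow\Delta$; $\Gamma\Rightarrow\Delta,\top$. $(R0)$ from $\Gamma\Rightarrow\Delta$ infer $\Gamma\Rightarrow\Delta,0$. $(L1)$ from $\Gamma\Rightarrow\Delta$ infer $1,\Gamma\Rightarrow\Delta$. $(L\otimes)$ from $\Gamma,A,B\Rightarrow\Delta$ infer $A\otimes B,\Gamma\Rightarrow\Delta$. $(R\otimes)$ from $\Gamma\Rightarrow\Delta,A$ and $\Gamma'\Rightarrow\Delta',B$ infer $\Gamma,\Gamma'\Rightarrow\Delta,\Delta',A\otimes B$. $(L\oplus)$ from $A,\Gamma\Rightarrow\Delta$ and $B,\Gamma'\Rightarrow\Delta'$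 infer $A\oplus B,\Gamma,\Gamma'\Rightarrow\Delta,\Delta'$. $(R\oplus)$ from $\Gamma\Rightarrow\Delta,A,B$ infer $\Gamma\Rightarrow\Delta,A\oplus B$. $(L\land_1),(L\land_2)$ from $A,\Gamma\Rightarrow\Delta$, respectively from $B,\Gamma\Rightarrow\Delta$, infer $A\land B,\Gamma\Rightarrow\Delta$. $(R\land)$ from $\Gamma\Rightarrow\Delta,A$ and $\Gamma\Rightarrow\Delta,B$ infer $\Gamma\Rightarrow\Delta,A\land B$. $(L\lor)$ from $A,\Gamma\Rightarrow\Delta$ and $B,\Gamma\Rightarrow\Delta$ infer $A\lor B,\Gamma\Rightarrow\Delta$. $(R\lor_1),(R\lor_2)$ from $\Gamma\Rightarrow\Delta,A$, respectively from $\Gamma\Rightarrow\Delta,B$, infer $\Gamma\Rightarrow\Delta,A\lor B$. $(L\neg)$ from $\Gamma\Rightarrow\Delta,A$ infer $\neg A,\Gamma\Rightarrow\Delta$. $(R\neg)$ from $A,\Gamma\Rightarrow\Delta$ infer $\Gamma\Rightarrow\Delta,\neg A$. $(L\to)$ from $\Gamma\Rightarrow\Delta,A$ and $B,\Gamma'\Rightarrow\Delta'$ infer $A\to B,\Gamma,\Gamma'\Rightarrow\Delta,\Delta'$. $(R\to)$ from $A,\Gamma\Rightarrow\Delta,B$ infer $\Gamma\Rightarrow\Delta,A\to B$. $\mathbf{GAMALL}$ (a calculus for Affine Logic) is $\mathbf{GMALL}$ extended with the weakening rules $(LW)$: from $\Gamma\Rightarrow\Delta$ infer $A,\Gamma\Rightarrow\Delta$;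 $(RW)$: from $\Gamma\Rightarrow\Delta$ infer $\Gamma\Rightarrow\Delta,A$. The Tarskian modalities are the abbreviations $\Diamond A := \neg A\to A$ and $\boxdot A := \neg\Diamond\neg A$. *)

(* Defs.v *)
From HB Require Import structures.
From mathcomp Require Import all_boot.
From mathcomp Require Import finmap multiset.

Set Implicit Arguments.
Unset Strict Implicit.
Unset Printing Implicit Defensive.

Local Open Scope mset_scope.

(* Fzero and Fone are the multiplicative units 0 and 1, Fbot and Ftop the
   additive constants; Ftensor/Fpar are the multiplicative conjunction and
   disjunction, Fand/For the additive ones. *)
Inductive formula : Type :=
| Fvar of nat
| Fzero | Fone | Fbot | Ftop
| Ftensor of formula & formula
| Fpar of formula & formula
| Fand of formula & formula
| For of formula & formula
| Fneg of formula
| Fimp of formula & formula.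

(* {mset formula} needs a choice structure on formulae, obtained here from an
   encoding into labelled trees. *)
Fixpoint formula_encode (A : formula) : GenTree.tree nat :=
  match A with
  | Fvar n => GenTree.Leaf n
  | Fzero => GenTree.Node 0 [::]
  | Fone => GenTree.Node 1 [::]
  | Fbot => GenTree.Node 2 [::]
  | Ftop => GenTree.Node 3 [::]
  | Ftensor B C => GenTree.Node 4 [:: formula_encode B; formula_encode C]
  | Fpar B C => GenTree.Node 5 [:: formula_encode B; formula_encode C]
  | Fand B C => GenTree.Node 6 [:: formula_encode B; formula_encode C]
  | For B C => GenTree.Node 7 [:: formula_encode B; formula_encode C]
  | Fneg B => GenTree.Node 8 [:: formula_encode B]
  | Fimp B C => GenTree.Node 9 [:: formula_encode B; formula_encode C]
  end.

Fixpoint formula_decode (t : GenTree.tree nat) : formula :=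
  match t with
  | GenTree.Leaf n => Fvar n
  | GenTree.Node 0 _ => Fzero
  | GenTree.Node 1 _ => Fone
  | GenTree.Node 2 _ => Fbot
  | GenTree.Node 3 _ => Ftop
  | GenTree.Node 4 [:: t1; t2] => Ftensor (formula_decode t1) (formula_decode t2)
  | GenTree.Node 5 [:: t1; t2] => Fpar (formula_decode t1) (formula_decode t2)
  | GenTree.Node 6 [:: t1; t2] => Fand (formula_decode t1) (formula_decode t2)
  | GenTree.Node 7 [:: t1; t2] => For (formula_decode t1) (formula_decode t2)
  | GenTree.Node 8 [:: t1] => Fneg (formula_decode t1)
  | GenTree.Node 9 [:: t1; t2] => Fimp (formula_decode t1) (formula_decode t2)
  | _ => Fzero
  end.

Lemma formula_encodeK : cancel formula_encode formula_decode.
Proof. by elim=> //= [A -> B ->|A -> B ->|A -> B ->|A -> B ->|A ->|A -> B ->]. Qed.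

HB.instance Definition _ := Countable.copy formula (can_type formula_encodeK).

Definition Fdiamond (A : formula) : formula := Fimp (Fneg A) A.
Definition Fboxdot (A : formula) : formula := Fneg (Fdiamond (Fneg A)).

Definition sequent : Type := ({mset formula} * {mset formula})%type.

Declare Scope sequent_scope.
Delimit Scope sequent_scope with seqt.
Notation "G ⇒ D" := ((G%mset, D%mset) : sequent) (at level 70) : sequent_scope.
Local Open Scope sequent_scope.

(* A rule (or a whole calculus) is the set of its instances, each given by the
   list of its premisses and its conclusion; axioms have no premiss. *)
Definition rule : Type := seq sequent -> sequent -> Prop.

Implicit Types (A B : formula) (G D : {mset formula}).

Inductive GMALL : rule :=
| Ax A : GMALL [::] ([mset A] ⇒ [mset A])
| L0 : GMALL [::] ([mset Fzero] ⇒ mset0)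
| R1 : GMALL [::] (mset0 ⇒ [mset Fone])
| Lbot G D : GMALL [::] (Fbot +` G ⇒ D)
| Rtop G D : GMALL [::] (G ⇒ D `+` [mset Ftop])
| R0 G D : GMALL [:: G ⇒ D] (G ⇒ D `+` [mset Fzero])
| L1 G D : GMALL [:: G ⇒ D] (Fone +` G ⇒ D)
| Ltensor A B G D :
    GMALL [:: G `+` [mset A] `+` [mset B] ⇒ D] (Ftensor A B +` G ⇒ D)
| Rtensor A B G G' D D' :
    GMALL [:: G ⇒ D `+` [mset A]; G' ⇒ D' `+` [mset B]]
          (G `+` G' ⇒ D `+` D' `+` [mset Ftensor A B])
| Lpar A B G G' D D' :
    GMALL [:: A +` G ⇒ D; B +` G' ⇒ D']
          (Fpar A B +` G `+` G' ⇒ D `+` D')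
| Rpar A B G D :
    GMALL [:: G ⇒ D `+` [mset A] `+` [mset B]] (G ⇒ D `+` [mset Fpar A B])
| Land1 A B G D : GMALL [:: A +` G ⇒ D] (Fand A B +` G ⇒ D)
| Land2 A B G D : GMALL [:: B +` G ⇒ D] (Fand A B +` G ⇒ D)
| Rand A B G D :
    GMALL [:: G ⇒ D `+` [mset A]; G ⇒ D `+` [mset B]]
          (G ⇒ D `+` [mset Fand A B])
| Lor A B G D :
    GMALL [:: A +` G ⇒ D; B +` G ⇒ D] (For A B +` G ⇒ D)
| Ror1 A B G D : GMALL [:: G ⇒ D `+` [mset A]] (G ⇒ D `+` [mset For A B])
| Ror2 A B G D : GMALL [:: G ⇒ D `+` [mset B]] (G ⇒ D `+` [mset For A B])
| Lneg A G D : GMALL [:: G ⇒ D `+` [mset A]] (Fneg A +` G ⇒ D)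
| Rneg A G D : GMALL [:: A +` G ⇒ D] (G ⇒ D `+` [mset Fneg A])
| Limp A B G G' D D' :
    GMALL [:: G ⇒ D `+` [mset A]; B +` G' ⇒ D']
          (Fimp A B +` G `+` G' ⇒ D `+` D')
| Rimp A B G D :
    GMALL [:: A +` G ⇒ D `+` [mset B]] (G ⇒ D `+` [mset Fimp A B]).

Inductive GAMALL : rule :=
| GAMALL_GMALL ps S : GMALL ps S -> GAMALL ps S
| LW A G D : GAMALL [:: G ⇒ D] (A +` G ⇒ D)
| RW A G D : GAMALL [:: G ⇒ D] (G ⇒ D `+` [mset A]).

(* derives C H S: there is a derivation tree of S whose inner nodes are
   instances of C and whose leaves are axioms of C or sequents from H; a rule with premisses H and
   conclusion S is derivable in C when this holds for each of its instances. *)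
Inductive derives (C : rule) (H : seq sequent) : sequent -> Prop :=
| derives_hyp S : S \in H -> derives C H S
| derives_rule ps S :
    C ps S -> (forall P, P \in ps -> derives C H P) -> derives C H S.

(* Main.v *)
Require Import Defs.
From mathcomp Require Import all_boot.
From mathcomp Require Import finmap multiset.

Local Open Scope mset_scope.
Local Open Scope sequent_scope.

(** Unfolded, [Fdiamond A] is the implication from [Fneg A] to [A], so its right
    rule is implication introduction whose antecedent [Fneg A] is supplied by a
    left weakening; this is the only use of affinity. The left rule for
    [Fboxdot A], which is [Fneg (Fdiamond (Fneg A))], follows by duality: move
    [A] to the right as [Fneg A], apply the right rule for the diamond to
    [Fneg A], and move the result back to the left under a negation. *)

Lemma derives_unary (C : rule) (H : seq sequent) (P S : sequent) :
  C [:: P] S -> derives C H P -> derives C H S.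
Proof.
move=> CPS dP; apply: (derives_rule CPS) => Q.
by rewrite inE => /eqP ->.
Qed.

(** The hypotheses [H] are arbitrary, so that the rule can be used in the middle
    of a derivation, as the rule for [Fboxdot] requires. *)
Lemma derives_Rdiamond (H : seq sequent) (A : formula)
    (G D : {mset formula}) :
  derives GAMALL H (G ⇒ D `+` [mset A]) ->
  derives GAMALL H (G ⇒ D `+` [mset Fdiamond A]).
Proof.
move=> dA; apply: derives_unary (GAMALL_GMALL (Rimp _ _ _ _)) _.
exact: derives_unary (LW _ _ _) dA.
Qed.

Lemma derives_Lboxdot (H : seq sequent) (A : formula)
    (G D : {mset formula}) :
  derives GAMALL H (G `+` [mset A] ⇒ D) ->
  derives GAMALL H (G `+` [mset Fboxdot A] ⇒ D).
Proof.
rewrite !(msetDC G) => dA.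
apply: derives_unary (GAMALL_GMALL (Lneg _ _ _)) _.
apply: derives_Rdiamond.
exact: derives_unary (GAMALL_GMALL (Rneg _ _ _)) dA.
Qed.

Theorem mainTheorem8 :
  (forall (A : formula) (G D : {mset formula}),
     derives GAMALL [:: G ⇒ D `+` [mset A]] (G ⇒ D `+` [mset Fdiamond A])) /\
  (forall (A : formula) (G D : {mset formula}),
     derives GAMALL [:: G `+` [mset A] ⇒ D] (G `+` [mset Fboxdot A] ⇒ D)).
Proof.
split=> A G D.
- by apply: derives_Rdiamond; apply: derives_hyp; rewrite mem_head.
- by apply: derives_Lboxdot; apply: derives_hyp; rewrite mem_head.
Qed.
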